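(* Fix $p>0$. Let $\ell$ be the set of real sequences, $\mathbf e_j\in\ell$ the $j$-th unit vector, $\mathcal X=\{\mathbf e_1,\mathbf e_2,\dots\}$, and identify $f=(f_j)\in\ell$ with the function $f(\mathbf e_j)=f_j$ on $\mathcal X$. Let $B_p=\{g\in\ell:|g_j|\le j^{-1/p}\ \forall j\}$ and $\mathcal F=\{f\in\ell: f_j=(1+g_j)/2,\ g\in B_p\}$. Then: (a) there is a constant $A$ depending only on $p$ such that $\mathcal H_2(\mathcal F,\epsilon)\le(A/\epsilon)^p$ for all $\epsilon>0$ and all $n$; (b) there is an absolute constant $c>0$ such that for every $n\ge1$, $\inf_{\hat f}\sup\mathbb E\|\hat f-\eta\|^2\ge cn^{-2/(2+p)}$, where the supremum is over distributions of $(X,Y)$ on $\mathcal X\times\{0,1\}$ with $\eta\in\mathcal F$; (c) if $p\ge2$, for every $n\ge1$, $\inf_{\hat f}\sup_{P_{XY}}\{\mathbb E\|\hat f-\eta\|^2-\inf_{f\in\mathcal F}\|f-\eta\|^2\}\ge cn^{-1/(p-1)}$, the supremum over all distributions on $\mathcal X\times[0,1]$.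
   Context: A sample $D_n$ consists of $n$ i.i.d. copies of $(X,Y)$; estimators $\hat f$ are measurable functions of $D_n$ with values in $\ell$; $\eta(x)=\mathbb E[Y\mid X=x]$; $\|f\|^2=\int f^2\,d\mu_X$ with $\mu_X$ the law of $X$. For $S=\{(x_i,y_i)\}_{i\le n}$, $\mathcal N_2(\mathcal F,\epsilon,S)$ is the minimal size of an $\epsilon$-cover of $\mathcal F$ in the pseudo-metric $(\frac1n\sum_i(f(x_i)-g(x_i))^2)^{1/2}$, and $\mathcal H_2(\mathcal F,\epsilon)=\sup_S\log\mathcal N_2(\mathcal F,\epsilon,S)$ over all $S\in(\mathcal X\times[0,1])^n$. *)

(* Defs.v *)
From HB Require Import structures.
From mathcomp Require Import all_boot all_order all_algebra.
From mathcomp Require Import all_classical all_reals all_analysis.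
Set Implicit Arguments. Unset Strict Implicit. Unset Printing Implicit Defensive.
Import Order.TTheory GRing.Theory Num.Theory.
Local Open Scope classical_set_scope.
Local Open Scope ring_scope.

(* Conventions.  The space X = {e_1, e_2, ...} is identified with nat:
   the index k : nat stands for the unit vector e_(k+1).  A sequence
   f = (f_j)_(j>=1) in ell is a function nat -> R, f k = f_(k+1).
   Observations (X, Y) live in nat * R (product sigma-algebra of the
   discrete sigma-algebra on nat and the Borel sigma-algebra on R). *)

Section defs.
Variable R : realType.

Definition obs := (nat * R)%type.

Definition Bp (p : R) : set (nat -> R) :=
  [set g | forall k : nat, `|g k| <= (k.+1%:R) `^ (- (1 / p))].

Definition Fclass (p : R) : set (nat -> R) :=
  [set f | exists2 g, Bp p g & f = (fun k => (1 + g k) / 2)].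

Definition emp_dist (n : nat) (S : n.-tuple obs) (f g : nat -> R) : R :=
  Num.sqrt (n%:R^-1 * \sum_(i < n) (f (tnth S i).1 - g (tnth S i).1) ^+ 2).

Definition is_cover (F : set (nat -> R)) (eps : R) (n : nat) (S : n.-tuple obs)
  (k : nat) (C : 'I_k -> nat -> R) : Prop :=
  (forall i, F (C i)) /\ forall f, F f -> exists i, emp_dist S f (C i) <= eps.

Definition N2 (F : set (nat -> R)) (eps : R) (n : nat) (S : n.-tuple obs)
  : \bar R :=
  ereal_inf [set (k%:R)%:E | k in [set k : nat | exists C : 'I_k -> nat -> R, is_cover F eps S C]].

Definition lnbar (x : \bar R) : \bar R :=
  match x with
  | r%:E => (ln r)%:E
  | +oo%E => +oo%E
  | -oo%E => -oo%E
  end.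

Definition H2 (F : set (nat -> R)) (eps : R) (n : nat) : \bar R :=
  ereal_sup [set lnbar (N2 F eps S) | S in
    [set S : n.-tuple obs | forall i, 0 <= (tnth S i).2 <= 1]].

Definition muX (P : probability obs R) (k : nat) : R :=
  fine (P ([set k] `*` setT)).

(* eta(x) = E[Y | X = x]  (elementary conditional expectation, X discrete;
   arbitrary (= 0) where mu_X({x}) = 0, which is irrelevant below) *)
Definition etaP (P : probability obs R) (k : nat) : R :=
  fine (\int[P]_(z in [set k] `*` setT) (z.2)%:E)%E / muX P k.

Definition sqnorm (P : probability obs R) (f : nat -> R) : \bar R :=
  (\int[P]_z ((f z.1) ^+ 2)%:E)%E.

(* E_{D_n ~ P^n} [h(D_n)] : expectation w.r.t. the n-fold product of P,
   written as the iterated integral (Fubini-Tonelli) *)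
Fixpoint iexpect (P : probability obs R) (n : nat)
  : (n.-tuple obs -> \bar R) -> \bar R :=
  match n return (n.-tuple obs -> \bar R) -> \bar R with
  | 0 => fun h => h [tuple]
  | m.+1 => fun h => (\int[P]_z iexpect P (fun t => h (cons_tuple z t)))%E
  end.

(* estimator: a measurable map from samples of size n into ell
   (product sigma-algebra on ell = all coordinates measurable) *)
Definition estimator (n : nat) (fhat : n.-tuple obs -> nat -> R) : Prop :=
  forall k : nat, measurable_fun setT (fun D => fhat D k).

Definition risk (P : probability obs R) (n : nat)
  (fhat : n.-tuple obs -> nat -> R) : \bar R :=
  iexpect P (fun D => sqnorm P (fun k => fhat D k - etaP P k)).

Definition binary_law (P : probability obs R) : Prop :=
  P (setT `*` [set 0; 1]) = 1%E.

Definition unit_law (P : probability obs R) : Prop :=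
  P (setT `*` [set y : R | 0 <= y <= 1]) = 1%E.

(* eta_P belongs to F (some mu_X-version of eta lies in F) *)
Definition eta_in (F : set (nat -> R)) (P : probability obs R) : Prop :=
  exists2 f, F f & forall k, muX P k != 0 -> etaP P k = f k.

End defs.

(* Main.v *)
(* (a) Coordinate k of Fclass is an interval of length t_k = (k+1)^(-1/p).  Only
   the coordinates with t_k >= eps, about Q = eps^(-p) of them, need to be
   discretised; each needs at most 2 t_k / eps = 2 (Q / (k+1))^(1/p) cells, so
   the code has size at most 2^M (Q^M / M!)^(1/p) <= 2^M exp(Q/p), M = floor Q.

   (b), (c) Both follow from Assouad's lemma on the uniform design over d atoms
   with Bernoulli responses of mean 1/2 +- delta: some sign vector has risk at
   least delta^2 (1 - 8 n delta^2 / d).  For (b), d ~ n^(p/(2+p)) and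
   delta ~ n^(-1/(2+p)) keep eta inside the class.  For (c), delta = 1/2 makes Y a
   deterministic function of X and eta far outside the class; the class still
   approximates eta within (1 - d^(-1/p))/4, whereas an unseen atom costs 1/4 to
   the estimator, and d ~ n^(p/(p-1)) leaves most atoms unseen. *)

Require Import Defs.
From HB Require Import structures.
From mathcomp Require Import all_boot all_order all_algebra.
From mathcomp Require Import all_classical all_reals all_analysis.
From mathcomp Require Import measurable_realfun ring lra.
Set Implicit Arguments. Unset Strict Implicit. Unset Printing Implicit Defensive.
Import Order.TTheory GRing.Theory Num.Theory.
Local Open Scope classical_set_scope.
Local Open Scope ring_scope.

(** * Finitely supported laws *)

Lemma finite_law_exists (R : realType) (d : measure_display)
    (T : measurableType d) (I : finType) (pt : I -> T) (w : I -> R) :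
    (forall i, 0 <= w i) -> \sum_i w i = 1 ->
  exists P : probability T R, forall (D : set T) (f : T -> R),
    measurable D -> measurable_fun setT f ->
    (\int[P]_(x in D) (f x)%:E)%E = (\sum_i w i * (\1_D (pt i) * f (pt i)))%:E.
Proof.
move=> w0 w1.
(* [P] is the sum of the weighted Dirac masses. [msum] sums a sequence indexed by [nat], so the
   family is padded with zero measures from [#|I|] on. *)
pose m (k : nat) : {measure set T -> \bar R} :=
  if @insub nat (fun j => j < #|I|)%N 'I_#|I| k is Some j
  then mscale (NngNum (w0 (enum_val j))) \d_(pt (enum_val j)) else mzero.
have mE (k : 'I_#|I|) :
    m k = mscale (NngNum (w0 (enum_val k))) \d_(pt (enum_val k)).
  by rewrite /m valK.
have sum_enum (F : I -> R) : \sum_(k < #|I|) F (enum_val k) = \sum_i F i.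
  by rewrite -(big_enum_val F); apply: eq_bigl.
have m1 : msum m #|I| setT = 1%E.
  rewrite /msum; transitivity (\sum_(k < #|I|) (w (enum_val k))%:E)%E.
    apply: eq_bigr => k _; rewrite mE -[RHS]mule1.
    by congr (_ * _)%E; exact: diracT.
  by rewrite sumEFin sum_enum w1.
pose P : probability T R := HB.pack (msum m #|I|) (Measure_isProbability.Build _ _ _ _ m1).
exists P => D f mD mf.
(* Nonnegative integrands come first; signed ones follow from their positive and negative parts. *)
have ge0 (g : T -> R) : (forall x, 0 <= g x) -> measurable_fun setT g ->
    (\int[P]_(x in D) (g x)%:E)%E = (\sum_i w i * (\1_D (pt i) * g (pt i)))%:E.
  move=> g0 mg.
  have mg' : measurable_fun D (fun x => (g x)%:E).
    by apply/measurable_EFinP; exact: measurable_funTS.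
  rewrite ge0_integral_measure_sum//=; last by move=> x _; rewrite lee_fin.
  rewrite -sum_enum -sumEFin.
  apply: eq_bigr => k _.
  rewrite mE ge0_integral_mscale//=; last by move=> x _; rewrite lee_fin.
  by rewrite integral_dirac//= diracE !EFinM indicE.
rewrite integralE.
have -> : (fun x => (f x)%:E)^\+%E = fun x => (f^\+%R x)%:E.
  by apply/funext => x; rewrite funeposE/= -EFin_max.
have -> : (fun x => (f x)%:E)^\-%E = fun x => (f^\-%R x)%:E.
  by apply/funext => x; rewrite funenegE/= -EFin_max.
rewrite !ge0//.
- rewrite -EFinB -sumrB; congr (_%:E); apply: eq_bigr => i _.
  by rewrite -!mulrBr -[in RHS](funrposBneg f).
- exact: measurable_funrneg.
- exact: measurable_funrpos.
Qed.

(** Expectation under the n-fold product of the law with mass [w i] at [pt i]. The recursion mirrors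
    [iexpect], so the two can be compared by induction on [n]. *)
Fixpoint fexp (R : realType) (T : Type) (I : finType) (pt : I -> T)
    (w : I -> R) (n : nat) : (n.-tuple T -> R) -> R :=
  match n return (n.-tuple T -> R) -> R with
  | 0 => fun h => h [tuple]
  | m.+1 => fun h => \sum_i w i * fexp pt w (fun t => h (cons_tuple (pt i) t))
  end.

Lemma fexpZ (R : realType) (T : Type) (I : finType) (pt : I -> T)
    (w : I -> R) (n : nat) (c : R) (h : n.-tuple T -> R) :
  fexp pt w (fun s => c * h s) = c * fexp pt w h.
Proof.
elim: n h => [//|n IHn] h /=.
by rewrite mulr_sumr; apply: eq_bigr => i _; rewrite IHn mulrCA.
Qed.

Lemma fexp_sum (R : realType) (T : Type) (I J : finType) (pt : I -> T)
    (w : I -> R) (n : nat) (h : J -> n.-tuple T -> R) :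
  fexp pt w (fun s => \sum_j h j s) = \sum_j fexp pt w (h j).
Proof.
elim: n h => [//|n IHn] h /=.
rewrite exchange_big; apply: eq_bigr => i _.
by rewrite IHn mulr_sumr.
Qed.

Lemma measurable_fexp (R : realType) (d : measure_display)
    (T : measurableType d) (I : finType) (pt : I -> T) (w : I -> R) (n : nat)
    (H : T -> n.-tuple T -> R) :
    (forall t, measurable_fun setT (H ^~ t)) ->
  measurable_fun setT (fun z => fexp pt w (H z)).
Proof.
elim: n H => [|n IHn] H mH /=; first exact: mH.
apply: measurable_sum => i; apply: measurable_funM => //.
by apply: IHn => t; exact: mH.
Qed.

Lemma iexpect_finite (R : realType) (I : finType) (pt : I -> obs R)
    (w : I -> R) (P : probability (obs R) R) :
    (forall f : obs R -> R, measurable_fun setT f ->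
      (\int[P]_z (f z)%:E)%E = (\sum_i w i * f (pt i))%:E) ->
  forall (n : nat) (h : n.-tuple (obs R) -> R), measurable_fun setT h ->
  iexpect P (fun s => (h s)%:E) = (fexp pt w h)%:E.
Proof.
move=> intP; elim=> [//|n IHn] h mh /=.
have mcons (f : obs R -> obs R) (g : obs R -> n.-tuple (obs R)) :
    measurable_fun setT f -> measurable_fun setT g ->
    measurable_fun setT (fun z => h (cons_tuple (f z) (g z))).
  by move=> mf mg; apply: measurableT_comp => //; exact: measurable_cons.
rewrite -(intP (fun z => fexp pt w (fun t => h (cons_tuple z t)))); last first.
  apply: (@measurable_fexp _ _ _ _ pt w n (fun z t => h (cons_tuple z t))) => t.
  exact: mcons.
apply: eq_integral => z _.
apply: IHn; apply: measurableT_comp => //.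
exact: (@measurable_cons _ _ _ _ (cst z) n id).
Qed.

(** * Two-point bounds and averaging over sign vectors *)

(** For [s = a + b > 0], the minimum of the right side over [x] is [(q - q')^2 * a * b / s], and
    with [g = sqrt (a * b)] the inequality [g^2 >= s * (g - s / 4)] is [(g - s / 2)^2 >= 0]. *)
Lemma two_point_base (R : realType) (a b x q q' : R) : 0 <= a -> 0 <= b ->
  (q - q') ^+ 2 * (Num.sqrt (a * b) - (a + b) / 4) <=
    a * (x - q) ^+ 2 + b * (x - q') ^+ 2.
Proof.
move=> a0 b0; set g := Num.sqrt (a * b).
have gE : g ^+ 2 = a * b by rewrite sqr_sqrtr ?mulr_ge0.
have g0 : 0 <= g by exact: sqrtr_ge0.
have [s0|s0] := leP (a + b) 0.
  have -> : a = 0 by lra.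
  have b_0 : b = 0 by lra.
  have g_0 : g = 0 by rewrite /g b_0 mulr0 sqrtr0.
  by rewrite g_0 b_0; lra.
rewrite -(ler_pM2l s0).
have h1 : (a + b) * (g - (a + b) / 4) <= a * b.
  by rewrite -gE; have := sqr_ge0 (g - (a + b) / 2); lra.
have h2 := ler_wpM2l (sqr_ge0 (q - q')) h1.
(* This square is what [a + b] times the right side has in excess of [a * b * (q - q')^2]. *)
have h3 := sqr_ge0 (a * (x - q) + b * (x - q')).
lra.
Qed.

(* The scalars [a] and [b] carry the likelihoods of the observations already
   integrated out; this is what makes the induction on the sample size work. *)
Lemma two_point (R : realType) (T : Type) (I : finType) (pt : I -> T)
    (w w' : I -> R) (n : nat) (h : n.-tuple T -> R) (a b q q' : R) :
    (forall i, 0 <= w i) -> (forall i, 0 <= w' i) ->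
    \sum_i w i = 1 -> \sum_i w' i = 1 -> 0 <= a -> 0 <= b ->
  (q - q') ^+ 2 *
      (Num.sqrt (a * b) * (\sum_i Num.sqrt (w i * w' i)) ^+ n - (a + b) / 4) <=
    a * fexp pt w (fun s => (h s - q) ^+ 2) +
    b * fexp pt w' (fun s => (h s - q') ^+ 2).
Proof.
move=> w0 w'0 w1 w'1.
elim: n h a b => [|n IHn] h a b a0 b0 /=.
  by rewrite expr0 mulr1; exact: two_point_base.
set rho := \sum_i _.
(* The bound splits over the first observation: outcome [i] replaces [a], [b] by [a * w i],
   [b * w' i], which is an instance of the induction hypothesis. *)
have -> : Num.sqrt (a * b) * rho ^+ n.+1 - (a + b) / 4 =
    \sum_i (Num.sqrt ((a * w i) * (b * w' i)) * rho ^+ n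
            - (a * w i + b * w' i) / 4).
  rewrite sumrB -!mulr_suml big_split/= -!mulr_sumr w1 w'1 !mulr1.
  congr (_ - _); rewrite exprS mulrA /rho mulr_sumr; congr (_ * _).
  apply: eq_bigr => i _.
  by rewrite mulrACA [in RHS]sqrtrM ?mulr_ge0.
rewrite !mulr_sumr -big_split/=; apply: ler_sum => i _.
rewrite [a * (w i * _)]mulrA [b * (w' i * _)]mulrA.
by apply: (IHn (fun t => h (cons_tuple (pt i) t))); rewrite mulr_ge0.
Qed.

Lemma bernoulli_inequality (R : realType) (x : R) (n : nat) :
  0 <= x <= 1 -> 1 - n%:R * x <= (1 - x) ^+ n.
Proof.
move=> /andP[x0 x1]; elim: n => [|n IHn]; first by rewrite expr0 mul0r subr0.
rewrite exprS -natr1.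
have : (1 - x) * (1 - n%:R * x) <= (1 - x) * (1 - x) ^+ n.
  by rewrite ler_wpM2l// subr_ge0.
apply: le_trans.
have : 0 <= n%:R * (x * x) by rewrite mulr_ge0// mulr_ge0.
lra.
Qed.

(** For fixed [j], reindexing by the involution [flip j] shows that [F j] averages at least [m] over
    [S]. Summing over [j], some [s] reaches the average; [s0] ensures that [S] is nonempty. *)
Lemma exists_average (R : realType) (J S : finType) (s0 : S)
    (flip : J -> S -> S) (F : J -> S -> R) (m : R) :
    (forall j, involutive (flip j)) ->
    (forall j s, 2 * m <= F j s + F j (flip j s)) ->
  exists s, #|J|%:R * m <= \sum_j F j s.
Proof.
move=> flipK hF; apply: contrapT => /forallNP hn.
have lt1 : \sum_s \sum_j F j s < \sum_(s : S) (#|J|%:R * m).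
  apply: ltr_sum => [|s _]; last by rewrite ltNge; apply/negP/hn.
  by apply/hasP; exists s0; rewrite ?mem_index_enum.
move: lt1; apply/negP; rewrite -leNgt sumr_const exchange_big/=.
rewrite (_ : _ *+ _ = \sum_(j : J) (m *+ #|S|)); last first.
  by rewrite sumr_const -[LHS]mulr_natl -[RHS]mulr_natl -[m *+ _]mulr_natl mulrCA.
apply: ler_sum => j _.
have -> : \sum_s F j s = (\sum_s (F j s + F j (flip j s))) / 2.
  rewrite big_split/= [X in _ + X](_ : _ = \sum_s F j s); first by lra.
  by rewrite [RHS](reindex_inj (inv_inj (flipK j))).
rewrite ler_pdivlMr//.
apply: (@le_trans _ _ (\sum_(s : S) (2 * m))); last exact: ler_sum.
by rewrite sumr_const -mulrnAr mulrC.
Qed.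

(** * Assouad's lemma on the hypercube *)

Definition hcube_mean (R : realType) (d : nat) (delta : R)
    (s : {ffun 'I_d -> bool}) (j : 'I_d) : R := 1 / 2 + (-1) ^+ s j * delta.

(** Joint mass of a uniform atom [z.1] and a Bernoulli label [z.2] of mean [hcube_mean]: the
    exclusive or reverses the sign of [delta] when the label is false. *)
Definition hcube_weight (R : realType) (d : nat) (delta : R)
    (s : {ffun 'I_d -> bool}) (z : 'I_d * bool) : R :=
  d%:R^-1 * (1 / 2 + (-1) ^+ (s z.1 (+) ~~ z.2) * delta).

Definition hcube_atom (R : realType) (d : nat) (z : 'I_d * bool) : obs R :=
  (z.1 : nat, z.2%:R).

Definition flip_bit (d : nat) (j : 'I_d) (s : {ffun 'I_d -> bool}) :
    {ffun 'I_d -> bool} := [ffun k => s k (+) (k == j)].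

Lemma flip_bitK (d : nat) (j : 'I_d) : involutive (flip_bit j).
Proof. by move=> s; apply/ffunP => k; rewrite !ffunE -addbA addbb addbF. Qed.

Lemma sum_pair_bool (R : realType) (d : nat) (F : 'I_d * bool -> R) :
  \sum_z F z = \sum_j (F (j, true) + F (j, false)).
Proof.
rewrite (eq_bigr (fun z => F (z.1, z.2))) => [|[]//].
rewrite -(pair_bigA _ (fun j b => F (j, b)))/=.
by apply: eq_bigr => j _; rewrite big_bool.
Qed.

Section hypercube.
Context (R : realType) (d : nat) (delta : R).
Implicit Types (s : {ffun 'I_d -> bool}) (j : 'I_d).
Hypotheses (d0 : (0 < d)%N) (delta01 : 0 <= delta <= 1 / 2).

Let d_neq0 : d%:R != 0 :> R. Proof. by rewrite pnatr_eq0 -lt0n. Qed.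

Lemma hcube_weight_ge0 s z : 0 <= hcube_weight delta s z.
Proof.
have /andP[? ?] := delta01.
rewrite /hcube_weight mulr_ge0 ?invr_ge0//.
by case: (_ (+) _); rewrite /= ?expr0 ?expr1; lra.
Qed.

Lemma hcube_weight_pair s j :
  hcube_weight delta s (j, true) + hcube_weight delta s (j, false) = d%:R^-1.
Proof. by rewrite /hcube_weight/=; case: (s j); rewrite /= ?expr0 ?expr1; lra. Qed.

Lemma sum_hcube_weight s : \sum_z hcube_weight delta s z = 1.
Proof.
rewrite sum_pair_bool (eq_bigr (fun=> d%:R^-1)) => [|j _].
  by rewrite sumr_const card_ord -[LHS]mulr_natl divff.
exact: hcube_weight_pair.
Qed.

(** The two laws agree off atom [j], which contributes [1 - 1/d]. On atom [j] the affinity is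
    [2 * sqrt (1/4 - delta^2) / d], at least [(1 - 4 * delta^2) / d]. *)
Lemma hcube_affinity s j :
  1 - 4 * delta ^+ 2 / d%:R <=
  \sum_z Num.sqrt (hcube_weight delta s z * hcube_weight delta (flip_bit j s) z).
Proof.
have /andP[? ?] := delta01.
have dV0 : 0 <= d%:R^-1 :> R by rewrite invr_ge0.
rewrite sum_pair_bool (bigD1 j)//=.
rewrite (eq_bigr (fun=> d%:R^-1)) => [|k kj]; last first.
  have flipE b : hcube_weight delta (flip_bit j s) (k, b) =
      hcube_weight delta s (k, b).
    by rewrite /hcube_weight ffunE /= (negbTE kj) addbF.
  rewrite !flipE -!expr2 !sqrtr_sqr !ger0_norm ?hcube_weight_ge0//.
  exact: hcube_weight_pair.
rewrite sumr_const cardC1 card_ord.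
have -> : d%:R^-1 *+ d.-1 = 1 - d%:R^-1 :> R.
  by rewrite -[LHS]mulr_natl -subn1 natrB// mulrBl divff// mul1r.
set x := 1 / 2 + delta; set y := 1 / 2 - delta.
(* This is [sqrt t >= 2 * t] for [0 <= t <= 1/4], at [t = x * y = 1/4 - delta^2]. *)
have xy : d%:R^-1 * (2 * (x * y)) <= Num.sqrt ((d%:R^-1 * x) * (d%:R^-1 * y)).
  rewrite -(@ger0_norm _ (d%:R^-1 * _)); last first.
    by rewrite mulr_ge0// mulr_ge0// mulr_ge0// /x /y; lra.
  rewrite -sqrtr_sqr ler_wsqrtr//.
  rewrite (_ : d%:R^-1 * x * _ = d%:R^-1 ^+ 2 * (x * y)); last by ring.
  rewrite exprMn ler_wpM2l ?sqr_ge0//.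
  have : 0 <= x * y * (4 * delta ^+ 2).
    by rewrite !mulr_ge0 ?sqr_ge0// /x /y; lra.
  by rewrite /x /y; lra.
have yx : Num.sqrt ((d%:R^-1 * y) * (d%:R^-1 * x)) =
    Num.sqrt ((d%:R^-1 * x) * (d%:R^-1 * y)) by rewrite mulrC.
have -> : Num.sqrt (hcube_weight delta s (j, true) *
      hcube_weight delta (flip_bit j s) (j, true)) +
    Num.sqrt (hcube_weight delta s (j, false) *
      hcube_weight delta (flip_bit j s) (j, false)) =
    2 * Num.sqrt ((d%:R^-1 * x) * (d%:R^-1 * y)).
  have wE s' b : hcube_weight delta s' (j, b) =
      d%:R^-1 * (if s' j (+) b then x else y).
    rewrite /hcube_weight /x /y /=.
    by case: (s' j); case: b; rewrite /= ?expr0 ?expr1; congr (_ * _); lra.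
  by rewrite !wE !ffunE eqxx; case: (s j); rewrite /= ?yx; lra.
by move: xy; rewrite /x /y; lra.
Qed.

End hypercube.

(** Reduces every quantity attached to [P] to a finite sum. The arbitrary [B] in the first clause
    lets it serve both [binary_law] and [unit_law]. *)
Lemma hcube_law_exists (R : realType) (d : nat) (delta : R)
    (s : {ffun 'I_d -> bool}) :
    (0 < d)%N -> 0 <= delta <= 1 / 2 ->
  exists P : probability (obs R) R,
  [/\ forall B : set R, measurable B -> B 0 -> B 1 -> P (setT `*` B) = 1%E,
      forall j : 'I_d, etaP P j = hcube_mean delta s j,
      forall k, (d <= k)%N -> muX P k = 0,
      forall g, sqnorm P g = (d%:R^-1 * \sum_(j < d) g j ^+ 2)%:E &
      forall (n : nat) (h : n.-tuple (obs R) -> R), measurable_fun setT h ->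
        iexpect P (fun D => (h D)%:E) =
        (fexp (@hcube_atom R d) (hcube_weight delta s) h)%:E].
Proof.
move=> d0 delta01.
have [P intP] := finite_law_exists (@hcube_atom R d)
  (hcube_weight_ge0 delta01 s) (sum_hcube_weight delta d0 s).
have intPT f : measurable_fun setT f -> (\int[P]_z (f z)%:E)%E =
    (\sum_i hcube_weight delta s i * f (hcube_atom R i))%:E.
  move=> mf; rewrite intP//; congr (_%:E); apply: eq_bigr => i _.
  by rewrite indicT mul1r.
have PE (D : set (obs R)) : measurable D -> P D =
    (\sum_i hcube_weight delta s i * \1_D (hcube_atom R i))%:E.
  move=> mD; rewrite -[P D]mul1e -integral_cst// intP//.
  by congr (_%:E); apply: eq_bigr => i _; rewrite mulr1.
have mslice k : measurable ([set k] `*` setT : set (obs R)).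
  exact: measurableX.
have sliceE k i : \1_([set k] `*` setT) (hcube_atom R i) =
    ((i.1 : 'I_d) == k :> nat)%:R :> R.
  rewrite indicE; congr (_%:R); congr nat_of_bool; apply/idP/eqP.
    by rewrite inE => -[].
  by move=> <-; rewrite inE.
have muE (j : 'I_d) : muX P j = d%:R^-1.
  rewrite /muX PE//= sum_pair_bool (bigD1 j)//= big1 ?addr0 => [|k kj].
    by rewrite !sliceE eqxx !mulr1 hcube_weight_pair.
  by rewrite !sliceE val_eqE (negbTE kj) !mulr0 addr0.
exists P; split.
- move=> B mB B0 B1; rewrite PE; last exact: measurableX.
  congr (_%:E); rewrite -(sum_hcube_weight delta d0 s).
  apply: eq_bigr => -[j b] _; rewrite indicE mem_set ?mulr1//.
  by split=> //=; case: b.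
- move=> j; rewrite /etaP muE (intP _ snd)//=.
  rewrite sum_pair_bool (bigD1 j)//= big1 ?addr0 => [|k kj].
    rewrite !sliceE eqxx /= !mulr0 addr0 !mulr1 /hcube_weight/= addbF.
    have dn0 : d%:R != 0 :> R by rewrite pnatr_eq0 -lt0n.
    by rewrite mulrC mulrA invrK divff// [LHS]mul1r.
  by rewrite !sliceE val_eqE (negbTE kj) !mul0r !mulr0 addr0.
- move=> k dk; rewrite /muX PE//= big1// => i _.
  by rewrite sliceE ltn_eqF ?mulr0// (leq_trans _ dk).
- move=> g; rewrite /sqnorm (intPT (fun z => g z.1 ^+ 2)).
    rewrite sum_pair_bool mulr_sumr; congr (_%:E); apply: eq_bigr => j _ /=.
    by rewrite -mulrDl hcube_weight_pair.
  apply: measurable_funX; apply: measurableT_comp => //.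
- by move=> n h mh; exact: iexpect_finite.
Qed.

(** The squared norm is an average over coordinates, so each coordinate is a two-point problem
    between [s] and its flip, and averaging over sign vectors combines them. [P] may depend on
    [fhat]: the lower bounds fix the estimator before taking the supremum. *)
Lemma assouad (R : realType) (d n : nat) (delta : R)
    (fhat : n.-tuple (obs R) -> nat -> R) :
    (0 < d)%N -> 0 <= delta <= 1 / 2 -> estimator fhat ->
  exists (P : probability (obs R) R) (s : 'I_d -> bool),
  [/\ forall B : set R, measurable B -> B 0 -> B 1 -> P (setT `*` B) = 1%E,
      forall j : 'I_d, etaP P j = 1 / 2 + (-1) ^+ s j * delta,
      forall k, (d <= k)%N -> muX P k = 0,
      forall g, sqnorm P g = (d%:R^-1 * \sum_(j < d) g j ^+ 2)%:E &
      ((delta ^+ 2 * (1 - 8 * n%:R * delta ^+ 2 / d%:R))%:E <= risk P fhat)%E].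
Proof.
move=> d0 delta01 mfhat.
have dgt0 : 0 < d%:R :> R by rewrite ltr0n.
pose F (j : 'I_d) s := fexp (@hcube_atom R d) (hcube_weight delta s)
  (fun D => (fhat D j - hcube_mean delta s j) ^+ 2).
set m := delta ^+ 2 * _.
(* At [a = b = 1] the two means are [2 * delta] apart, giving [4 * delta^2 * (rho^n - 1/2)], and
   [rho^n >= 1 - 4 * n * delta^2 / d] by Bernoulli's inequality. *)
have pairF j s : 2 * m <= F j s + F j (flip_bit j s).
  have := @two_point R _ _ (@hcube_atom R d) (hcube_weight delta s)
    (hcube_weight delta (flip_bit j s)) n (fhat^~ j) 1 1
    (hcube_mean delta s j) (hcube_mean delta (flip_bit j s) j)
    (hcube_weight_ge0 delta01 s) (hcube_weight_ge0 delta01 _)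
    (sum_hcube_weight delta d0 s) (sum_hcube_weight delta d0 _) ler01 ler01.
  rewrite !mul1r sqrtr1 mul1r => /(le_trans _); apply.
  have -> : (hcube_mean delta s j - hcube_mean delta (flip_bit j s) j) ^+ 2 =
      4 * delta ^+ 2.
    by rewrite /hcube_mean ffunE eqxx; case: (s j); rewrite /= ?expr0 ?expr1; ring.
  set rho := \sum_z _.
  have x01 : 0 <= 4 * delta ^+ 2 / d%:R <= 1.
    have d4 : 0 <= 4 * delta ^+ 2 by rewrite mulr_ge0// sqr_ge0.
    rewrite divr_ge0//= ler_pdivrMr// mul1r.
    rewrite (@le_trans _ _ 1)// ?ler1n//.
    have /andP[? ?] := delta01.
    have : delta * delta <= 1 / 2 * (1 / 2) by rewrite ler_pM.
    by rewrite expr2; lra.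
  have : 1 - n%:R * (4 * delta ^+ 2 / d%:R) <= rho ^+ n.
    apply: le_trans (bernoulli_inequality n x01) _.
    by apply: lerXn2r; rewrite ?nnegrE ?hcube_affinity//;
      [move: x01; lra | exact: sumr_ge0].
  move=> /(ler_wpM2l (_ : 0 <= 4 * delta ^+ 2)).
  rewrite mulr_ge0 ?sqr_ge0// => /(_ isT).
  by rewrite /m; lra.
have [s hs] := exists_average [ffun=> false] (@flip_bitK d) pairF.
have [P [P1 etaE mu0 normE expE]] := hcube_law_exists s d0 delta01.
exists P, s; split => //.
rewrite /risk; under [X in iexpect P X]funext => D do rewrite normE.
rewrite expE; last first.
  apply: measurable_funM => //; apply: measurable_sum => j.
  by apply: measurable_funX; apply: measurable_funB => //; exact: mfhat.
rewrite lee_fin fexpZ fexp_sum.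
under eq_bigr => j _ do rewrite (etaE j).
rewrite mulrC ler_pdivlMr// mulrC.
by move: hs; rewrite card_ord.
Qed.

(** * Lower bounds *)

Lemma minimax_lower_bound (R : realType) (p : R) (n : nat)
    (fhat : n.-tuple (obs R) -> nat -> R) :
    0 < p -> (0 < n)%N -> estimator fhat ->
  ((1 / 72 * n%:R `^ (- (2 / (2 + p))))%:E <=
    ereal_sup [set risk P fhat | P in
      [set P : probability (obs R) R | binary_law P /\ eta_in (Fclass p) P]])%E.
Proof.
move=> p0 n0 mfhat.
have n1 : 1 <= n%:R :> R by rewrite ler1n.
have nn0 : 0 < n%:R :> R by rewrite ltr0n.
have p2 : 0 < 2 + p by lra.
have pn0 : p != 0 by rewrite gt_eqF.
have p2n0 : 2 + p != 0 by rewrite gt_eqF.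
pose X : R := n%:R `^ (p / (2 + p)).
have X1 : 1 <= X by rewrite -(powRr0 n%:R) ler_powR// divr_ge0// ltW.
(* Rounded down, so that [d^(-1/p) >= X^(-1/p) = n^(-1/(2+p))], which exceeds the perturbation
   [2 * delta]. *)
pose d := Num.truncn X.
have /andP[dX Xd] : d%:R <= X < d.+1%:R by exact: truncn_itv (le_trans ler01 X1).
have d0 : (0 < d)%N.
  by rewrite -ltnS -(ltr_nat R) (le_lt_trans X1).
have d1 : 1 <= d%:R :> R by rewrite ler1n.
pose delta : R := n%:R `^ (- (1 / (2 + p))) / 6.
have delta0 : 0 <= delta by rewrite divr_ge0// powR_ge0.
have delta01 : 0 <= delta <= 1 / 2.
  rewrite delta0/= /delta.
  have : n%:R `^ (- (1 / (2 + p))) <= 1 :> R.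
    by rewrite -[leRHS](powRr0 n%:R) ler_powR// oppr_le0 divr_ge0// ltW.
  lra.
have delta2 : delta ^+ 2 = n%:R `^ (- (2 / (2 + p))) / 36.
  rewrite /delta exprMn -powR_mulrn ?powR_ge0// -powRrM.
  rewrite (_ : - (1 / (2 + p)) * 2 = - (2 / (2 + p))); last by field.
  by congr (_ * _); field.
have nd2 : n%:R * delta ^+ 2 = X / 36.
  rewrite delta2 mulrA -{1}(powRr1 (ltW nn0)) -powRD ?(gt_eqF nn0) ?implybT//.
  by congr (_ `^ _ / _); field.
have [P [s [P1 etaE mu0 _ hrisk]]] := assouad d0 delta01 mfhat.
apply: (@le_trans _ _ (risk P fhat)).
  apply: le_trans hrisk; rewrite lee_fin -[8 * _ * _]mulrA nd2.
  (* As [d >= 1], [X < d + 1 <= 2 * d]. The factor in the risk bound is then at least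
     [1 - 16/36 = 5/9], and [5/9 * 1/36 >= 1/72]. *)
  have : X / d%:R <= 2.
    by rewrite ler_pdivrMr ?ltr0n//; move: Xd; rewrite -natr1; lra.
  have : 0 <= delta ^+ 2 by exact: sqr_ge0.
  move=> /ler_wpM2l/[apply]; rewrite delta2.
  by have := powR_ge0 n%:R (- (2 / (2 + p))); lra.
apply: ereal_sup_ubound; exists P => //; split.
  apply: P1; [|by left|by right].
  by apply: measurableU; exact: measurable_set1.
exists (fun k => (1 + (if (k < d)%N then 2 * etaP P k - 1 else 0)) / 2).
  exists (fun k => if (k < d)%N then 2 * etaP P k - 1 else 0) => // k.
  case: ifPn => [kd|_]; last by rewrite normr0 powR_ge0.
  rewrite (etaE (Ordinal kd)).
  have -> : `|2 * (1 / 2 + (-1) ^+ s (Ordinal kd) * delta) - 1| = 2 * delta.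
    case: (s _); rewrite /= ?expr0 ?expr1.
      rewrite (_ : _ - 1 = - (2 * delta)); last by field.
      by rewrite normrN ger0_norm// mulr_ge0.
    rewrite (_ : _ - 1 = 2 * delta); last by field.
    by rewrite ger0_norm// mulr_ge0.
  apply: (@le_trans _ _ (n%:R `^ (- (1 / (2 + p))))).
    by move: delta0; rewrite /delta; lra.
  rewrite !powRN lef_pV2 ?posrE ?powR_gt0//.
  rewrite (_ : 1 / (2 + p) = p / (2 + p) * (1 / p)); last by field; rewrite ?pn0 ?p2n0.
  rewrite powRrM; apply: ge0_ler_powR; rewrite ?nnegrE ?ler0n//.
  - by rewrite divr_ge0// ltW.
  - by apply: le_trans dX; rewrite ler_nat.
move=> k; case: ltnP => [kd _|dk]; last by rewrite mu0 ?eqxx.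
by field.
Qed.

Lemma agnostic_lower_bound (R : realType) (p : R) (n : nat)
    (fhat : n.-tuple (obs R) -> nat -> R) :
    2 <= p -> (0 < n)%N -> estimator fhat ->
  ((1 / 72 * n%:R `^ (- (1 / (p - 1))))%:E <=
    ereal_sup [set (risk P fhat -
        ereal_inf [set sqnorm P (fun k => (f k - etaP P k)%R) | f in Fclass p])%E
      | P in [set P : probability (obs R) R | unit_law P]])%E.
Proof.
move=> p2 n0 mfhat.
have n1 : 1 <= n%:R :> R by rewrite ler1n.
have nn0 : 0 < n%:R :> R by rewrite ltr0n.
have p0 : 0 < p by lra.
have p10 : 0 < p - 1 by lra.
have pn0 : p != 0 by rewrite gt_eqF.
have p1n0 : p - 1 != 0 by rewrite gt_eqF.
have n41 : 1 <= 4 * n%:R :> R by lra.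
pose X : R := (4 * n%:R) `^ (p / (p - 1)).
have X1 : 1 <= X.
  by rewrite -(powRr0 (4 * n%:R)) ler_powR// divr_ge0// ltW.
(* Rounded up, so that [d^(1 - 1/p) >= X^((p-1)/p) = 4 * n], that is [4 * n / d <= tau]. *)
pose d := (Num.truncn X).+1.
have /andP[dX Xd] : (Num.truncn X)%:R <= X < d%:R.
  exact: truncn_itv (le_trans ler01 X1).
have d0 : (0 < d)%N by [].
have dd0 : 0 < d%:R :> R by rewrite ltr0n.
have dX2 : d%:R <= 2 * X by rewrite /d -[in leLHS]natr1; lra.
pose tau : R := d%:R `^ (- (1 / p)).
have tau0 : 0 <= tau by exact: powR_ge0.
have ntau : 4 * n%:R / d%:R <= tau.
  rewrite ler_pdivrMr// /tau -[Y in _ <= _ * Y](powRr1 (ltW dd0)).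
  rewrite -powRD ?(gt_eqF dd0) ?implybT//.
  have -> : 4 * n%:R = X `^ (- (1 / p) + 1).
    rewrite -powRrM (_ : p / (p - 1) * (- (1 / p) + 1) = 1); last by field; rewrite ?pn0 ?p1n0.
    by rewrite powRr1// mulr_ge0.
  apply: ge0_ler_powR; rewrite ?nnegrE ?(ltW Xd) ?(le_trans ler01 X1)//.
  have : 1 / p <= 1 by rewrite ler_pdivrMr//; lra.
  lra.
(* From [d <= 2 * X], [d^(1/p) <= 2^(1/p) * (4 * n)^(1/(p-1))]; both exponents are at most 1 because
   [p >= 2], whence the factor [8 = 2 * 4]. *)
have htau : n%:R `^ (- (1 / (p - 1))) / 8 <= tau.
  rewrite /tau !powRN -invfM lef_pV2 ?posrE ?mulr_gt0 ?powR_gt0//.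
  apply: (@le_trans _ _ ((2 * X) `^ (1 / p))).
    by apply: ge0_ler_powR; rewrite ?nnegrE ?ler0n// ?divr_ge0// ?(ltW p0)//; lra.
  rewrite powRM ?(le_trans ler01 X1)// -powRrM.
  rewrite (_ : p / (p - 1) * (1 / p) = 1 / (p - 1)); last by field; rewrite ?pn0 ?p1n0.
  rewrite powRM ?ler0n//.
  have h2 : 2 `^ (1 / p) <= 2 :> R.
    by rewrite -[leRHS]powRr1// ler_powR ?ler1n// ler_pdivrMr//; lra.
  have h4 : 4 `^ (1 / (p - 1)) <= 4 :> R.
    by rewrite -[leRHS]powRr1// ler_powR ?ler1n// ler_pdivrMr//; lra.
  rewrite mulrA [leRHS]mulrC ler_wpM2r ?powR_ge0//.
  by rewrite (_ : 8 = 2 * 4) ?ler_pM ?powR_ge0//; lra.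
have half01 : 0 <= (1 / 2 : R) <= 1 / 2 by rewrite lexx divr_ge0.
have [P [s [P1 etaE _ normE hrisk]]] := assouad d0 half01 mfhat.
pose t k : R := k.+1%:R `^ (- (1 / p)).
(* On the atoms, [f] goes from 1/2 towards the 0-1 value of [etaP] as far as the class allows, which
   leaves the error [(1 - t k) / 2]. *)
pose f k : R := (1 + (if (k < d)%N then (2 * etaP P k - 1) * t k else 0)) / 2.
have sgnE (j : 'I_d) : (2 * etaP P j - 1 = 1) \/ (2 * etaP P j - 1 = -1).
  by rewrite etaE; case: (s j); rewrite /= ?expr0 ?expr1; [right|left]; lra.
have t1 k : 0 <= t k <= 1.
  rewrite powR_ge0/= -[leRHS](powRr0 k.+1%:R) ler_powR ?ler1n//.
  by rewrite oppr_le0 divr_ge0// ltW.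
have fF : Fclass p f.
  exists (fun k => if (k < d)%N then (2 * etaP P k - 1) * t k else 0) => // k.
  case: ifPn => [kd|_]; last by rewrite normr0 powR_ge0.
  rewrite normrM [X in _ * X]ger0_norm ?powR_ge0// ler_piMl ?powR_ge0//.
  by case: (sgnE (Ordinal kd)) => /= ->; rewrite ?normrN normr1.
have normf : (sqnorm P (fun k => (f k - etaP P k)%R) <= ((1 - tau) / 4)%:E)%E.
  rewrite normE lee_fin mulrC ler_pdivrMr// mulr_natr -[d in _ *+ d]card_ord.
  rewrite -sumr_const; apply: ler_sum => j _.
  have tj : tau <= t j.
    rewrite /tau /t !powRN lef_pV2 ?posrE ?powR_gt0//.
    apply: ge0_ler_powR; rewrite ?nnegrE ?ler0n ?ler_nat//.
    by rewrite divr_ge0// ltW.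
  have /andP[t0 tle1] := t1 j.
  have -> : (f j - etaP P j) ^+ 2 = ((1 - t j) / 2) ^+ 2.
    rewrite /f ltn_ord; set e := etaP P j in sgnE *.
    by have [e1|e1] := sgnE j; [have -> : e = 1 by rewrite /e; lra|
      have -> : e = 0 by rewrite /e; lra]; field.
  have : (1 - t j) * (1 - t j) <= (1 - t j) * 1 by rewrite ler_wpM2l; lra.
  by rewrite expr2; lra.
(* The difference is [tau / 4 - n / (2 * d) >= tau / 8], hence at least [n^(-1/(p-1)) / 64]. *)
apply: (@le_trans _ _ ((1 / 4 * (1 - 2 * n%:R / d%:R))%:E - ((1 - tau) / 4)%:E)%E).
  rewrite -EFinB lee_fin.
  have : 0 <= n%:R `^ (- (1 / (p - 1))) :> R by exact: powR_ge0.
  by move: ntau htau; lra.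
apply: (@le_trans _ _ (risk P fhat - ereal_inf [set sqnorm P (fun k => (f k - etaP P k)%R) | f in Fclass p])%E).
  apply: leeB.
    by apply: le_trans hrisk; rewrite lee_fin; lra.
  by apply: le_trans normf; apply: ereal_inf_lbound; exists f.
apply: ereal_sup_ubound; exists P => //.
apply: P1; last 2 first.
- by rewrite /= lexx ler01.
- by rewrite /= lexx ler01.
by rewrite -set_itvcc; exact: measurable_itv.
Qed.

(** * Metric entropy *)

Lemma emp_dist_le (R : realType) (n : nat) (S : n.-tuple (obs R))
    (f g : nat -> R) (eps : R) :
    0 <= eps -> (forall k, `|f k - g k| <= eps) -> emp_dist S f g <= eps.
Proof.
move=> eps0 fg; rewrite /emp_dist -[leRHS](ger0_norm eps0) -sqrtr_sqr.
rewrite ler_wsqrtr//.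
have : \sum_(i < n) (f (tnth S i).1 - g (tnth S i).1) ^+ 2 <=
    \sum_(i < n) eps ^+ 2.
  by apply: ler_sum => i _; rewrite -real_normK ?num_real// lerXn2r// ?nnegrE.
(* For the empty sample the sum is empty, so the distance is 0. *)
rewrite sumr_const card_ord; case: n S => [|n] S h.
  by rewrite big_ord0 mulr0 sqr_ge0.
by rewrite mulrC ler_pdivrMr ?ltr0n// mulr_natr.
Qed.

(** One member of [F] is chosen for each code value as a centre; [f0] fills in for values that no
    member attains, so every centre lies in [F]. *)
Lemma cover_of_code (R : realType) (F : set (nat -> R)) (eps : R) (n : nat)
    (S : n.-tuple (obs R)) (I : finType) (code : (nat -> R) -> I)
    (f0 : nat -> R) : F f0 ->
    (forall f g, F f -> F g -> code f = code g -> emp_dist S f g <= eps) ->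
  exists C : 'I_#|I| -> nat -> R, is_cover F eps S C.
Proof.
move=> Ff0 codeF.
have rep (i : I) : exists g, F g /\ forall f, F f -> code f = i -> code g = i.
  have [[f [Ff fi]]|h] := pselect (exists f, F f /\ code f = i).
    by exists f.
  by exists f0; split=> // f Ff fi; exfalso; apply: h; exists f.
have {}rep i := cid (rep i).
exists (fun k => sval (rep (enum_val k))); split=> [k|f Ff].
  by case: (svalP (rep (enum_val k))).
exists (enum_rank (code f)); rewrite enum_rankK.
by case: (svalP (rep (code f))) => Fg gcode; apply: codeF => //; rewrite (gcode f).
Qed.

Lemma lnbar_N2_le (R : realType) (F : set (nat -> R)) (eps : R) (n : nat)
    (S : n.-tuple (obs R)) (k : nat) (C : 'I_k -> nat -> R) :
  (0 < k)%N -> is_cover F eps S C -> (lnbar (N2 F eps S) <= (ln k%:R)%:E)%E.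
Proof.
move=> k0 hC.
have N2k : (N2 F eps S <= k%:R%:E)%E.
  by apply: ereal_inf_lbound; exists k => //; exists C.
have N20 : (0 <= N2 F eps S)%E.
  by apply: le_ereal_inf_tmp => _ [j _ <-]; rewrite lee_fin.
move: N2k N20; case: (N2 F eps S) => [r| |]//=; rewrite !lee_fin => rk r0.
(* At 0, [ln] takes its default value 0, which is at most [ln k] since [k >= 1]. *)
move: r0; rewrite le_eqVlt => /predU1P[<-|r0].
  by rewrite ln0// ln_ge0// ler1n.
by rewrite ler_ln// posrE ltr0n.
Qed.

Lemma truncn_eq_dist (R : realType) (x y : R) :
  0 <= x -> 0 <= y -> Num.truncn x = Num.truncn y -> `|x - y| <= 1.
Proof.
move=> x0 y0 xy.
have /andP[x1 x2] := truncn_itv x0; have /andP[y1 y2] := truncn_itv y0.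
rewrite xy in x1 x2; rewrite -natr1 in x2; rewrite -natr1 in y2.
by rewrite ler_norml; lra.
Qed.

Lemma expn_fact_le_expR (R : realType) (x : R) (n : nat) :
  0 <= x -> x ^+ n / n`!%:R <= expR x.
Proof.
case: n => [|n] x0.
  by rewrite expr0 fact0 divr1 -expR0 ler_expR.
by apply: le_trans (expR_ge1Dxn n x0); rewrite lerDr.
Qed.

(** * Coding the class at scale [eps] *)

Section entropy.
Context (R : realType) (p eps : R).
Hypotheses (p0 : 0 < p) (eps0 : 0 < eps).

(** Half-width of coordinate [k] in [Bp], hence the full length of its interval in [Fclass]. *)
Let halfwidth (k : nat) : R := k.+1%:R `^ (- (1 / p)).
Let Q : R := eps `^ (- p).
Let M : nat := Num.truncn Q.
Let cells (k : nat) : nat := (Num.truncn (halfwidth k / eps)).+1.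

Let Q0 : 0 < Q. Proof. exact: powR_gt0. Qed.

Let M_itv : M%:R <= Q < M.+1%:R. Proof. by apply: truncn_itv; exact: ltW. Qed.

Let QV : Q `^ (1 / p) = eps^-1.
Proof.
rewrite /Q -powRrM (_ : - p * (1 / p) = -1) ?powR_inv1 ?ltW//.
by field; rewrite gt_eqF.
Qed.

Let halfwidth_div k : halfwidth k / eps = (Q / k.+1%:R) `^ (1 / p).
Proof.
rewrite powRM ?invr_ge0 ?(ltW Q0)// QV mulrC; congr (_ * _).
by rewrite /halfwidth -[k.+1%:R^-1]powR_inv1// -powRrM mulN1r.
Qed.

Let Fclass_itv f k : Fclass p f -> 0 <= f k - (1 - halfwidth k) / 2 <= halfwidth k.
Proof. by case=> g /(_ k) gk ->; move: gk; rewrite -/(halfwidth k) ler_norml; lra. Qed.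

Let code (f : nat -> R) : {dffun forall k : 'I_M, 'I_(cells k)} :=
  @finfun _ (fun k : 'I_M => 'I_(cells k))
    (fun k => inord (Num.truncn ((f k - (1 - halfwidth k) / 2) / eps))).

(** Below [M], equal codes put both values in one cell of length [eps]. From [M] on, [k + 1 > Q]
    makes the whole interval no longer than [eps]. The bound is uniform in [k], so it serves every
    sample. *)
Let code_dist f g : Fclass p f -> Fclass p g -> code f = code g ->
  forall k, `|f k - g k| <= eps.
Proof.
move=> Ff Fg fg k.
have /andP[f0 f1] := Fclass_itv k Ff; have /andP[g0 g1] := Fclass_itv k Fg.
have [kM|Mk] := ltnP k M.
  have := congr1 (fun c : {dffun forall k : 'I_M, 'I_(cells k)} =>
    nat_of_ord (c (Ordinal kM))) fg.
  rewrite /code !ffunE /= !inordK; last 2 first.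
  - by rewrite ltnS le_truncn// ler_pM2r// invr_gt0.
  - by rewrite ltnS le_truncn// ler_pM2r// invr_gt0.
  move/truncn_eq_dist; rewrite !divr_ge0 ?(ltW eps0)// => /(_ isT isT).
  rewrite (_ : _ - _ = (f k - g k) / eps); last by field; rewrite gt_eqF.
  by rewrite normrM (gtr0_norm (_ : 0 < eps^-1)) ?invr_gt0// ler_pdivrMr// mul1r.
have tk : halfwidth k <= eps.
  rewrite -[leRHS]mul1r -ler_pdivrMr// halfwidth_div.
  rewrite -[leRHS](_ : 1 `^ (1 / p) = 1); last by rewrite powR1.
  apply: ge0_ler_powR; rewrite ?nnegrE ?divr_ge0 ?ltW//.
  rewrite ltr_pdivrMr// mul1r; have /andP[_] := M_itv.
  by move=> /lt_le_trans; apply; rewrite ler_nat.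
by rewrite ler_norml; lra.
Qed.

Let card_code m : (m <= M)%N ->
  (\prod_(k < m) cells k)%:R <= 2 ^+ m * (Q ^+ m / m`!%:R) `^ (1 / p).
Proof.
have pV0 : 0 <= 1 / p by rewrite divr_ge0// ltW.
elim: m => [_|m IHm mM].
  by rewrite big_ord0 expr0 mul1r expr0 fact0 divr1 powR1.
rewrite big_ord_recr natrM /=.
have Q1 : 1 <= Q / m.+1%:R.
  rewrite ler_pdivlMr// mul1r; have /andP[+ _] := M_itv.
  by apply: le_trans; rewrite ler_nat.
(* Since [m + 1 <= M <= Q], the ratio [halfwidth m / eps] is at least 1, so the extra cell at most
   doubles it. *)
have cm : (cells m)%:R <= 2 * (Q / m.+1%:R) `^ (1 / p).
  have hw0 : 0 <= halfwidth m / eps by rewrite divr_ge0 ?powR_ge0 ?ltW.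
  have /andP[cm _] := truncn_itv hw0.
  have : 1 <= (Q / m.+1%:R) `^ (1 / p).
    by rewrite -[leLHS](powRr0 (Q / m.+1%:R)) ler_powR.
  by rewrite -halfwidth_div => h1; rewrite /cells -[in leLHS]natr1; lra.
have := ler_pM _ _ (IHm (ltnW mM)) cm => /(_ (ler0n _ _) (ler0n _ _)).
move=> /le_trans; apply.
rewrite exprSr factS natrM exprSr invfM (mulrC m.+1%:R^-1).
rewrite (_ : Q ^+ m * Q * _ = Q ^+ m / m`!%:R * (Q / m.+1%:R)); last by ring.
rewrite [(_ / m`!%:R * _) `^ _]powRM ?divr_ge0 ?exprn_ge0 ?(ltW Q0)//.
by rewrite mulrACA.
Qed.

(** The logarithm of the code size is at most [M * ln 2 + ln (Q^M / M!) / p]. Here [M <= Q],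
    [ln 2 <= 1], and [Q^M / M!] is one term of the series of [expR Q]. *)
Lemma H2_Fclass_le (n : nat) :
  (H2 (Fclass p) eps n <= (eps `^ (- p) * (1 + 1 / p))%:E)%E.
Proof.
apply: ge_ereal_sup => _ [S _ <-].
have F0 : Fclass p (fun k => (1 + 0) / 2).
  by exists (fun=> 0) => // k; rewrite normr0 powR_ge0.
have [C hC] : exists C : 'I_#|{dffun forall k : 'I_M, 'I_(cells k)}| -> nat -> R,
    is_cover (Fclass p) eps S C.
  apply: (cover_of_code (code := code) F0) => f g Ff Fg fg.
  by apply: emp_dist_le; [exact: ltW | exact: code_dist].
have cardE : #|{dffun forall k : 'I_M, 'I_(cells k)}| = (\prod_(k < M) cells k)%N.
  rewrite card_dep_ffun foldrE big_map big_enum /=.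
  by apply: eq_bigr => k _; rewrite card_ord.
have prod0 : (0 < \prod_(k < M) cells k)%N by rewrite prodn_gt0.
rewrite cardE in C hC.
apply: le_trans (lnbar_N2_le prod0 hC) _; rewrite lee_fin.
have Y0 : 0 < Q ^+ M / M`!%:R by rewrite divr_gt0 ?exprn_gt0 ?ltr0n ?fact_gt0.
apply: (@le_trans _ _ (ln (2 ^+ M * (Q ^+ M / M`!%:R) `^ (1 / p)))).
  rewrite ler_ln ?posrE ?ltr0n// ?card_code// mulr_gt0 ?exprn_gt0 ?powR_gt0//.
rewrite lnM ?posrE ?exprn_gt0 ?powR_gt0// ln_powR lnXn// mulrDr mulr1.
have /andP[MQ _] := M_itv.
apply: lerD.
  apply: le_trans MQ; rewrite -[leLHS]mulr_natr ler_piMl//.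
  by rewrite -ler_expR lnK ?posrE//; exact: expR_ge1Dx.
have pV0 : 0 <= 1 / p by rewrite divr_ge0// ltW.
rewrite mulrC ler_wpM2r//.
rewrite -ler_expR lnK ?posrE//.
exact: expn_fact_le_expR (ltW Q0).
Qed.

End entropy.

(** * Assembly of the three bounds *)

Theorem theorem7 (R : realType) :
  (* (a) *)
  (forall p : R, 0 < p ->
    exists2 A : R, 0 < A &
      forall (eps : R) (n : nat), 0 < eps ->
        (H2 (Fclass p) eps n <= ((A / eps) `^ p)%:E)%E) /\
  exists2 c : R, 0 < c &
  (* (b) *)
  (forall (p : R) (n : nat), 0 < p -> (0 < n)%N ->
    forall fhat : n.-tuple (obs R) -> nat -> R, estimator fhat ->
      ((c * n%:R `^ (- (2 / (2 + p))))%:E <=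
        ereal_sup [set risk P fhat | P in
          [set P : probability (obs R) R | binary_law P /\ eta_in (Fclass p) P]])%E)
  /\
  (* (c) *)
  (forall (p : R) (n : nat), 2 <= p -> (0 < n)%N ->
    forall fhat : n.-tuple (obs R) -> nat -> R, estimator fhat ->
      ((c * n%:R `^ (- (1 / (p - 1))))%:E <=
        ereal_sup [set (risk P fhat -
                        ereal_inf [set sqnorm P (fun k => (f k - etaP P k)%R) | f in Fclass p])%E
                   | P in [set P : probability (obs R) R | unit_law P]])%E).
Proof.
split.
  move=> p p0; have b0 : 0 < 1 + 1 / p by rewrite addr_gt0// divr_gt0.
  (* Chosen so that [(A / eps)^p = (1 + 1/p) * eps^(-p)]. *)
  exists ((1 + 1 / p) `^ (1 / p)); first exact: powR_gt0.
  move=> eps n eps0; apply: le_trans (H2_Fclass_le p0 eps0 n) _.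
  rewrite lee_fin powRM ?powR_ge0 ?invr_ge0 ?(ltW eps0)// -powRrM.
  rewrite divfK ?gt_eqF// powRr1 ?(ltW b0)//.
  by rewrite -(powR_inv1 (ltW eps0)) -powRrM mulN1r mulrC.
exists (1 / 72); first by rewrite divr_gt0.
split=> p n hp n0 fhat mfhat.
- exact: minimax_lower_bound.
- exact: agnostic_lower_bound.
Qed.
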